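(* Let $\mathcal{A}\in\mathbb{R}^{I_1\times\cdots\times I_D}$ be a tensor given by a tensor train (TT) in site-$1$-mixed-canonical form, and run the TT-to-truncated-HOSVD algorithm described in the context with truncated SVDs. For $d=1,\ldots,D$ let $\mathbf{A}_d$ be the $I_d$-row matrix whose SVD is truncated in step $d$ of the algorithm (formed from the current, i.e. already updated, $d$th core), let $\sigma_d(i_d)$ be its $i_d$th largest singular value, and let $S_d$ be the number of singular values retained in step $d$. Let $\hat{\mathcal{A}}=\mathcal{S}\times_1\mathbf{U}_1\times_2\cdots\times_D\mathbf{U}_D$ be the tensor computed by the algorithm. Then $$\|\mathcal{A}-\hat{\mathcal{A}}\|_F^2=\sum_{d=1}^{D}\sum_{i_d=S_d+1}^{I_d}\sigma_d(i_d)^2 .$$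
   Context: All tensors are real; $\|\cdot\|_F^2$ is the sum of squares of all entries. Multi-indices are linearized with the first index running fastest: $[i_1i_2\cdots i_D]=i_1+\sum_{k=2}^D(i_k-1)\prod_{l=1}^{k-1}I_l$; ''reshape'' keeps this linear order and ''permute'' reorders the indices. The $d$-mode product $\mathcal{A}\times_d\mathbf{U}$ of $\mathcal{A}$ with $\mathbf{U}\in\mathbb{R}^{J\times I_d}$ has entries $\sum_{i_d}\mathcal{A}(i_1,\ldots,i_d,\ldots,i_D)\,\mathbf{U}(j,i_d)$ (index $j$ in position $d$). A TT of $\mathcal{A}$ is a set of cores $\mathcal{A}^{(d)}\in\mathbb{R}^{R_d\times I_d\times R_{d+1}}$, $1\le d\le D$, with $R_1=R_{D+1}=1$, such that $\mathcal{A}(i_1,\ldots,i_D)=\sum_{r_1,\ldots,r_D}\mathcal{A}^{(1)}(r_1,i_1,r_2)\cdots\mathcal{A}^{(D)}(r_D,i_D,r_1)$. A core is left-orthogonal if its reshaping to an $R_dI_d\times R_{d+1}$ matrix has orthonormal columns, and right-orthogonal if its reshaping to an $R_d\times I_dR_{d+1}$ matrix has orthonormal rows. The TT is in site-$d$-mixed-canonical form if cores $1,\ldots,d-1$ are left-orthogonal and cores $d+1,\ldots,D$ are right-orthogonal. Algorithm (TT to truncated HOSVD). Input: a TT of $\mathcal{A}$ in site-$1$-mixed-canonical form and an accuracy $\epsilon$; set $\delta=\epsilon\|\mathcal{A}\|_F/\sqrt{D}$. For $d=1,\ldots,D$: (1) Let $\mathbf{A}_d$ be the $I_d\times(R_dR_{d+1})$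 matrix obtained from the current core $\mathcal{A}^{(d)}$ with entries $\mathbf{A}_d(i_d,[r_dr_{d+1}])=\mathcal{A}^{(d)}(r_d,i_d,r_{d+1})$. Compute a truncated SVD $\mathbf{A}_d=\mathbf{U}_d\mathbf{S}\mathbf{V}^T+\mathbf{E}$, retaining the $S_d\geq1$ largest singular values, with $\|\mathbf{E}\|_F\le\delta$; here $\mathbf{U}_d\in\mathbb{R}^{I_d\times S_d}$ has orthonormal columns. (2) Let $\mathcal{T}\in\mathbb{R}^{R_d\times S_d\times R_{d+1}}$ be $\mathbf{S}\mathbf{V}^T$ reshaped to $S_d\times R_d\times R_{d+1}$ with its first two indices swapped. (3) If $d=D$, set $\mathcal{S}^{(D)}=\mathcal{T}$. Otherwise reshape $\mathcal{T}$ to an $R_dS_d\times R_{d+1}$ matrix, compute its thin QR decomposition $\mathbf{Q}\mathbf{R}$ ($\mathbf{Q}$ with orthonormal columns), let $\mathcal{S}^{(d)}$ be $\mathbf{Q}$ reshaped to a 3-way core with first two dimensions $R_d,S_d$, and replace $\mathcal{A}^{(d+1)}$ by $\mathcal{A}^{(d+1)}\times_1\mathbf{R}$. (If $R_dS_d<R_{d+1}$, then $\mathbf{Q}$ has $R_dS_d$ columns and $R_{d+1}$ is replaced by $R_dS_d$ from then on.) Output: factor matrices $\mathbf{U}_1,\ldots,\mathbf{U}_D$ and the Tucker core $\mathcal{S}\in\mathbb{R}^{S_1\times\cdots\times S_D}$ whose TT-cores are $\mathcal{S}^{(1)},\ldots,\mathcal{S}^{(D)}$. Convention: singular values $\sigma_d(i_d)$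 with $i_d>\min(I_d,\text{number of columns of }\mathbf{A}_d)$ are zero. *)

(* Defs.v *)
From mathcomp Require Import all_boot all_order all_algebra.

Set Implicit Arguments.
Unset Strict Implicit.
Unset Printing Implicit Defensive.

Import Order.TTheory GRing.Theory Num.Theory.
Local Open Scope ring_scope.

(* Positions, indices and singular values are numbered from 0: site d.+1 of    *)
(* the literature is site d here. Dimensions, ranks and cores are families     *)
(* over nat of which only the members below D (ranks: up to D) are ever used;  *)
(* this makes "core d has right rank r d.+1" hold by conversion.               *)

Definition midx (D : nat) (n : nat -> nat) : finType :=
  {dffun forall d : 'I_D, 'I_(n d)}.

Definition tensor (K : Type) (D : nat) (n : nat -> nat) := {ffun midx D n -> K}.

Definition core (K : Type) (p n q : nat) := {ffun 'I_p * 'I_n * 'I_q -> K}.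

Definition frob2 (K : rcfType) (D : nat) (n : nat -> nat) (A : tensor K D n) : K :=
  \sum_i A i ^+ 2.

Definition fnorm (K : rcfType) (D : nat) (n : nat -> nat) (A : tensor K D n) : K :=
  Num.sqrt (frob2 A).

Definition mx_fnorm (K : rcfType) (m n : nat) (E : 'M[K]_(m, n)) : K :=
  Num.sqrt (\sum_i \sum_j E i j ^+ 2).

(* A x_d U, where m agrees with n outside position d. *)
Definition modeprod (K : rcfType) (D : nat) (n m : nat -> nat) (d : 'I_D)
    (A : tensor K D n) (U : 'M[K]_(m d, n d)) : tensor K D m :=
  [ffun j : midx D m =>
     \sum_(i : midx D n | [forall k, (k != d) ==> (i k == j k :> nat)])
        A i * U (j d) (i d)].

(* Dimensions of S x_0 U_0 ... x_{k-1} U_{k-1}, for S of dimensions s. *)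
Definition mixdims (I s : nat -> nat) (k : nat) : nat -> nat :=
  fun l => if (l < k)%N then I l else s l.

Lemma mixdims_lt I s k l : (l < k)%N -> mixdims I s k l = I l.
Proof. by rewrite /mixdims => ->. Qed.

Lemma mixdims_diag I s k : mixdims I s k k = s k.
Proof. by rewrite /mixdims ltnn. Qed.

Fixpoint multi_modeprod (K : rcfType) (D : nat) (I s : nat -> nat)
    (S : tensor K D s) (U : forall d : nat, 'M[K]_(I d, s d)) (k : nat) :
    (k <= D)%N -> tensor K D (mixdims I s k) :=
  match k with
  | 0 => fun=> S
  | k'.+1 => fun lt_kD =>
      @modeprod K D (mixdims I s k') (mixdims I s k'.+1) (Ordinal lt_kD)
        (multi_modeprod S U (ltnW lt_kD))
        (castmx (esym (mixdims_lt I s (ltnSn k')), esym (mixdims_diag I s k'))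
                (U k'))
  end.

(* S x_0 U_0 x_1 ... x_{D-1} U_{D-1} *)
Definition tucker (K : rcfType) (D : nat) (I s : nat -> nat)
    (S : tensor K D s) (U : forall d : nat, 'M[K]_(I d, s d)) : tensor K D I :=
  [ffun i : midx D I => multi_modeprod S U (leqnn D)
     [ffun d : 'I_D => cast_ord (esym (mixdims_lt I s (ltn_ord d))) (i d)]].

Definition mx_entry (K : rcfType) (I s : nat -> nat)
    (U : forall d : nat, 'M[K]_(I d, s d)) (d a b : nat) : K :=
  if insub a is Some i then if insub b is Some j then U d i j else 0 else 0.

Lemma mx_entryE (K : rcfType) (I s : nat -> nat)
    (U : forall d : nat, 'M[K]_(I d, s d))
    (d : nat) (i : 'I_(I d)) (j : 'I_(s d)) :
  mx_entry U d i j = U d i j.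
Proof. by rewrite /mx_entry !valK. Qed.

Lemma multi_modeprodE (K : rcfType) (D : nat) (I s : nat -> nat)
    (S : tensor K D s) (U : forall d : nat, 'M[K]_(I d, s d))
    (k : nat) (kD : (k <= D)%N) (i : midx D (mixdims I s k)) :
  multi_modeprod S U kD i =
  \sum_(t : midx D s | [forall l : 'I_D, (k <= l)%N ==> (t l == i l :> nat)])
     S t * \prod_(l < D | (l < k)%N) mx_entry U l (i l) (t l).
Proof.
elim: k kD i => [|k IH] kD i.
  rewrite /= (big_pred1 (i : midx D s)) ?big_pred0 ?mulr1 // => t.
  apply/forallP/eqP => [e|-> l] //=.
  by apply/ffunP => l; apply/val_inj/eqP; exact: (e l).
rewrite [LHS]ffunE -/multi_modeprod.
set d := Ordinal kD.
under eq_bigr => j _ do rewrite IH big_distrl /=.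
rewrite (exchange_big_dep (fun t : midx D s => [forall l : 'I_D, (k < l)%N ==> (t l == i l :> nat)])) /=; last first.
  move=> j t /forallP h1 /forallP h2; apply/forallP => l; apply/implyP => kl.
  have := h1 l; have := h2 l; rewrite (ltnW kl) /= => /eqP -> .
  by rewrite -val_eqE /= gtn_eqF.
apply: eq_bigr => t /forallP ht.
have lt_j (l : 'I_D) : ((if l == d then t l : nat else i l) < mixdims I s k l)%N.
  have [->|ne] := eqVneq l d; first by rewrite mixdims_diag.
  have := ltn_ord (i l); move: (nat_of_ord (i l)) => v; rewrite /mixdims ltnS [(l <= k)%N]leq_eqVlt.
  by rewrite -val_eqE /= in ne; rewrite (negbTE ne).
rewrite (big_pred1 ([ffun l => Ordinal (lt_j l)] : midx D (mixdims I s k))); last first.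
  move=> j; apply/andP/eqP => [[/forallP h1 /forallP h2]|->].
    apply/ffunP => l; rewrite ffunE; apply: val_inj => /=.
    have [eld|ne] := eqVneq l d.
      by have := h2 l; rewrite {1}eld leqnn /= => /eqP.
    by have := h1 l; rewrite ne /= => /eqP.
  split; apply/forallP => l; apply/implyP; rewrite ffunE /=.
    by move/negbTE->.
  rewrite leq_eqVlt -val_eqE /= eq_sym; have [//|ne /= kl] := eqVneq (val l) k.
  by have := ht l; rewrite kl.
rewrite -mulrA; congr (_ * _).
rewrite [RHS](bigD1 d) //= mulrC castmxE; congr (_ * _).
  rewrite -mx_entryE /=; congr mx_entry; rewrite ffunE /= eqxx //.
apply: eq_big => [l|l].
  by rewrite ltnS -val_eqE /= [RHS]andbC ltn_neqAle.
by move=> lk; rewrite ffunE /=; rewrite -val_eqE /= (ltn_eqF lk).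
Qed.

Lemma tuckerE (K : rcfType) (D : nat) (I s : nat -> nat)
    (S : tensor K D s) (U : forall d : nat, 'M[K]_(I d, s d))
    (i : midx D I) :
  tucker S U i = \sum_(t : midx D s) S t * \prod_(d < D) U d (i d) (t d).
Proof.
rewrite ffunE multi_modeprodE; apply: eq_big => [t|t _].
  by apply/forallP => l; rewrite leqNgt ltn_ord.
congr (_ * _); apply: eq_big => [l|l _]; first by rewrite ltn_ord.
by rewrite -mx_entryE ffunE.
Qed.

(* The column-major linear index of (a, b), the first component a running      *)
(* fastest, is mxvec_index b a:                                                *)
Lemma val_mxvec_index m n (i : 'I_m) (j : 'I_n) :
  mxvec_index i j = (i * n + j)%N :> nat.
Proof.
rewrite /mxvec_index /= /enum_rank enum_rank_in.unlock insubdK; last first.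
  by rewrite -topredE /= cardE index_mem mem_enum.
rewrite [enum _]enumT unlock /= /prod_enum.
have idx (s : seq 'I_m) : i \in s ->
    index (i, j) [seq (x, y) | x <- s, y <- enum 'I_n] = (index i s * n + j)%N.
  elim: s => // x s IH; rewrite allpairs_cons index_cat /=.
  have [->{x}|nix] := eqVneq x i => [_|].
    rewrite map_f ?mem_enum // index_map; last by move=> u v [].
    by rewrite index_enum_ord.
  rewrite inE eq_sym (negbTE nix) /= => /IH ->.
  case: ifP => [/mapP[u _ [eix _]]|_]; first by rewrite eix eqxx in nix.
  by rewrite size_map size_enum_ord mulSn addnA.
by rewrite idx ?mem_enum ?index_enum_ord.
Qed.

(* (p n) x q reshaping *)
Definition lunfold (K : rcfType) (p n q : nat) (C : core K p n q) : 'M[K]_(n * p, q) :=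
  \matrix_(k, b) mxvec (\matrix_(i < n, a < p) C (a, i, b)) 0 k.

(* p x (n q) reshaping *)
Definition runfold (K : rcfType) (p n q : nat) (C : core K p n q) : 'M[K]_(p, q * n) :=
  \matrix_(a, k) mxvec (\matrix_(b < q, i < n) C (a, i, b)) 0 k.

(* n x (p q) permuting and reshaping *)
Definition munfold (K : rcfType) (p n q : nat) (C : core K p n q) : 'M[K]_(n, q * p) :=
  \matrix_(i, k) mxvec (\matrix_(b < q, a < p) C (a, i, b)) 0 k.

Definition orthonormal_cols (K : rcfType) (m n : nat) (M : 'M[K]_(m, n)) : Prop :=
  M^T *m M = 1%:M.

Definition orthonormal_rows (K : rcfType) (m n : nat) (M : 'M[K]_(m, n)) : Prop :=
  M *m M^T = 1%:M.

Definition left_orthogonal (K : rcfType) (p n q : nat) (C : core K p n q) : Prop :=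
  orthonormal_cols (lunfold C).

Definition right_orthogonal (K : rcfType) (p n q : nat) (C : core K p n q) : Prop :=
  orthonormal_rows (runfold C).

Definition tt_tensor (K : rcfType) (D : nat) (n r : nat -> nat)
    (C : forall d : nat, core K (r d) (n d) (r d.+1)) : tensor K D n :=
  [ffun i : midx D n =>
     \sum_(a : {dffun forall k : 'I_D.+1, 'I_(r k)})
       \prod_(d < D) C d (a (widen_ord (leqnSn D) d), i d, a (lift ord0 d))].

(* As r 0 = r D = 1, the last summation index a_D of tt_tensor equals a_0.     *)
Definition is_tt (K : rcfType) (D : nat) (n r : nat -> nat) (A : tensor K D n)
    (C : forall d : nat, core K (r d) (n d) (r d.+1)) : Prop :=
  [/\ r 0%N = 1%N, r D = 1%N & A = tt_tensor D C].

Definition mixed_canonical (K : rcfType) (D : nat) (n r : nat -> nat)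
    (C : forall d : nat, core K (r d) (n d) (r d.+1)) (d : nat) : Prop :=
  (forall k, (k < d)%N -> left_orthogonal (C k)) /\
  (forall k, (d < k < D)%N -> right_orthogonal (C k)).

(* s lists the singular values of A in nonincreasing order, padded by zeros.   *)
Definition is_svd (K : rcfType) (m n : nat) (A : 'M[K]_(m, n))
    (U : 'M[K]_m) (s : nat -> K) (V : 'M[K]_n) : Prop :=
  [/\ orthonormal_cols U, orthonormal_cols V,
      [/\ forall i, 0 <= s i,
          forall i j, (i <= j)%N -> s j <= s i
        & forall i, (minn m n <= i)%N -> s i = 0]
    & A = U *m (\matrix_(i < m, j < n) if i == j :> nat then s i else 0) *m V^T].

(* Uk, Vk are the first k columns of the singular vectors of some SVD of A.    *)
Definition is_truncated_svd (K : rcfType) (m n k : nat) (A : 'M[K]_(m, n))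
    (Uk : 'M[K]_(m, k)) (s : nat -> K) (Vk : 'M[K]_(n, k)) : Prop :=
  exists (km : (k <= m)%N) (kn : (k <= n)%N) (U : 'M[K]_m) (V : 'M[K]_n),
    [/\ is_svd A U s V, Uk = colsub (widen_ord km) U & Vk = colsub (widen_ord kn) V].

(* S V^T for the k leading singular values *)
Definition svt (K : rcfType) (n k : nat) (s : nat -> K) (Vk : 'M[K]_(n, k)) :
    'M[K]_(k, n) :=
  diag_mx (\row_(i < k) s i) *m Vk^T.

Definition is_thin_qr (K : rcfType) (m n k : nat) (M : 'M[K]_(m, n))
    (Q : 'M[K]_(m, k)) (R : 'M[K]_(k, n)) : Prop :=
  [/\ k = minn m n, orthonormal_cols Q,
      forall (i : 'I_k) (j : 'I_n), (j < i)%N -> R i j = 0 & M = Q *m R].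

(* C x_1 M for a 3-way core *)
Definition core_modeprod1 (K : rcfType) (p n q p' : nat) (C : core K p n q)
    (M : 'M[K]_(p', p)) : core K p' n q :=
  [ffun x => \sum_(c < p) C (c, x.1.2, x.2) * M x.1.1 c].

(* Equality of cores whose dimensions are only propositionally equal. *)
Definition core_eq (K : rcfType) (p n q p' n' q' : nat)
    (C : core K p n q) (C' : core K p' n' q') : Prop :=
  [/\ p = p', n = n', q = q'
    & forall (a : 'I_p) (i : 'I_n) (b : 'I_q) (a' : 'I_p') (i' : 'I_n') (b' : 'I_q'),
        a = a' :> nat -> i = i' :> nat -> b = b' :> nat ->
        C (a, i, b) = C' (a', i', b')].

(* An execution of the algorithm on the TT C. Neither the SVDs nor the QR      *)
(* decompositions are unique, so C may have several executions.                *)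
Record hosvd_run (K : rcfType) (D : nat) (I r : nat -> nat)
    (C : forall d : nat, core K (r d) (I d) (r d.+1)) (delta : K) := HosvdRun {
  run_rank : nat -> nat;  (* left rank of core d at the start of step d *)
  run_size : nat -> nat;  (* S_d *)
  run_cur : forall d : nat, core K (run_rank d) (I d) (r d.+1); (* updated core d *)
  run_U : forall d : nat, 'M[K]_(I d, run_size d);
  run_sigma : nat -> nat -> K;
  run_V : forall d : nat, 'M[K]_(r d.+1 * run_rank d, run_size d);
  run_T : forall d : nat, core K (run_rank d) (run_size d) (r d.+1);
  run_R : forall d : nat, 'M[K]_(run_rank d.+1, r d.+1);
  run_S : forall d : nat, core K (run_rank d) (run_size d) (run_rank d.+1);
  run_init : core_eq (run_cur 0) (C 0%N);
  run_svd : forall d, (d < D)%N ->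
        [/\ (0 < run_size d)%N,
            is_truncated_svd (munfold (run_cur d))
              (run_U d) (run_sigma d) (run_V d),
            mx_fnorm (munfold (run_cur d)
                      - run_U d *m svt (run_sigma d) (run_V d)) <= delta
          & munfold (run_T d) = svt (run_sigma d) (run_V d)];
  run_qr : forall d, (d.+1 < D)%N ->
        is_thin_qr (lunfold (run_T d)) (lunfold (run_S d)) (run_R d) /\
        run_cur d.+1 = core_modeprod1 (C d.+1) (run_R d);
  run_last : forall d, d.+1 = D -> core_eq (run_S d) (run_T d)
}.

Definition run_output (K : rcfType) (D : nat) (I r : nat -> nat)
    (C : forall d : nat, core K (r d) (I d) (r d.+1)) (delta : K)
    (x : hosvd_run D C delta) : tensor K D I :=
  tucker (tt_tensor D (run_S x)) (run_U x).

(* Main.v *)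
(* Cut the train before site d and compare its exact tail with the computed
   one, both with the left boundary index open. The difference is the SVD
   residual of step d contracted with the tail of the original TT, plus the
   corresponding difference at site d+1 contracted with Q and U_d. The two
   summands are orthogonal because U_d^T E = 0; the first has norm |E|_F since
   right-orthogonal tails are orthonormal families, and the second keeps the norm
   of the difference at site d+1 since Q and U_d have orthonormal columns.
   Hence the squared errors add up. *)
Require Import Defs.
From mathcomp Require Import all_boot all_order all_algebra.
Import Order.TTheory GRing.Theory Num.Theory.
Local Open Scope ring_scope.

Set Implicit Arguments.
Unset Strict Implicit.
Unset Printing Implicit Defensive.

(** * Sums of squares under families with orthonormal columns *)

Section Sums.
Variable K : rcfType.

Lemma sum_sqr_isometry (X S : finType) (U : X -> S -> K) (v : S -> K) :
  (forall s s', \sum_x U x s * U x s' = (s == s')%:R) ->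
  \sum_x (\sum_s U x s * v s) ^+ 2 = \sum_s v s ^+ 2.
Proof.
move=> orthU.
under eq_bigr => x _ do rewrite expr2 big_distrlr /=.
rewrite exchange_big /=; apply: eq_bigr => s _.
rewrite exchange_big /= (bigD1 s) //= [X in _ + X]big1 => [|s' ne].
  under eq_bigr => x _ do rewrite mulrACA.
  by rewrite -big_distrl /= orthU eqxx mul1r addr0 expr2.
under eq_bigr => x _ do rewrite mulrACA.
by rewrite -big_distrl /= orthU eq_sym (negbTE ne) mul0r.
Qed.

(** Expanding the square, the cross term vanishes because [e] is orthogonal to every column of
    [U]. *)
Lemma sum_sqr_pythagoras (X S : finType) (U : X -> S -> K) (e : X -> K)
    (v : S -> K) :
  (forall s s', \sum_x U x s * U x s' = (s == s')%:R) ->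
  (forall s, \sum_x U x s * e x = 0) ->
  \sum_x (e x + \sum_s U x s * v s) ^+ 2
  = \sum_x e x ^+ 2 + \sum_s v s ^+ 2.
Proof.
move=> orthU orthe.
under eq_bigr => x _ do rewrite sqrrD.
rewrite !big_split /= sum_sqr_isometry //; congr (_ + _).
rewrite -[RHS]addr0; congr (_ + _).
rewrite (_ : \sum_x _ = 0) ?addr0 //.
under eq_bigr => x _ do rewrite mulr_sumr.
rewrite exchange_big /= big1 // => s _.
under eq_bigr => x _ do rewrite mulrCA mulrA.
by rewrite -big_distrl /= orthe mul0r.
Qed.

Lemma ord_eq1 n (a b : 'I_n) : n = 1%N -> a = b.
Proof. by move=> n1; subst n; rewrite (ord1 a) (ord1 b). Qed.

Lemma sum_ord_eq1 n (a : 'I_n) (F : 'I_n -> K) :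
  n = 1%N -> \sum_b F b = F a.
Proof. by move=> n1; subst n; rewrite big_ord1 (ord1 a). Qed.

End Sums.

(** * Splitting off the first component of a multi-index *)

Section MultiIndices.

(** Matching on [d] lets the type ['I_(n d)] compute in each branch, and the bound on [d'.+1] is by
    conversion one on [d']; hence no casts appear. *)
Definition midx_cons_at (D : nat) (n : nat -> nat) (x : 'I_(n 0%N))
    (j : midx D (fun d => n d.+1)) (d : nat) : (d < D.+1)%N -> 'I_(n d) :=
  match d with
  | 0 => fun=> x
  | d'.+1 => fun lt_dD => j (@Ordinal D d' lt_dD)
  end.

Definition midx_cons (D : nat) (n : nat -> nat) (x : 'I_(n 0%N))
    (j : midx D (fun d => n d.+1)) : midx D.+1 n :=
  [ffun d : 'I_D.+1 => midx_cons_at x j (ltn_ord d)].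

Definition midx_tail (D : nat) (n : nat -> nat) (i : midx D.+1 n) :
    midx D (fun d => n d.+1) :=
  [ffun d : 'I_D => i (lift ord0 d)].

Lemma midx_cons0 D n x j : @midx_cons D n x j ord0 = x.
Proof. by rewrite ffunE. Qed.

Lemma midx_consS D n x j (d : 'I_D) : @midx_cons D n x j (lift ord0 d) = j d.
Proof.
case: d => d lt_dD; rewrite ffunE /=.
set h := (X in Ordinal X); by rewrite (bool_irrelevance h lt_dD).
Qed.

Lemma midx_cons_widen0 D n x j :
  @midx_cons D.+1 n x j (widen_ord (leqnSn D.+1) ord0) = x.
Proof. by rewrite ffunE. Qed.

Lemma midx_cons_widenS D n x j (d : 'I_D) :
  @midx_cons D.+1 n x j (widen_ord (leqnSn D.+1) (lift ord0 d))
  = j (widen_ord (leqnSn D) d).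
Proof.
case: d => d lt_dD; rewrite ffunE /=.
set h := (X in Ordinal X); rewrite /widen_ord; set h' := widen_ord_proof _ _.
by rewrite (bool_irrelevance h h').
Qed.

Lemma midx_consK D n x j : midx_tail (@midx_cons D n x j) = j.
Proof. by apply/ffunP => d; rewrite ffunE midx_consS. Qed.

Lemma midx_cons_eta D n (i : midx D.+1 n) :
  midx_cons (i ord0) (midx_tail i) = i.
Proof.
apply/ffunP => d; case: (unliftP ord0 d) => [k ->|->].
  by rewrite midx_consS ffunE.
by rewrite midx_cons0.
Qed.

Lemma big_midxS (K : rcfType) D n (F : midx D.+1 n -> K) :
  \sum_i F i = \sum_x \sum_j F (midx_cons x j).
Proof.
rewrite pair_bigA /=.
rewrite (reindex (fun p : 'I_(n 0%N) * midx D (fun d => n d.+1) =>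
  midx_cons p.1 p.2)) //=.
exists (fun i : midx D.+1 n => (i ord0, midx_tail i)) => [[x j] _|i _] /=.
  by rewrite midx_cons0 midx_consK.
exact: midx_cons_eta.
Qed.

Lemma big_midx0 (K : rcfType) n (c : K) : \sum_(i : midx 0 n) c = c.
Proof.
have i0 : midx 0 n by apply: finfun => -[].
rewrite (big_pred1 i0) // => j; apply/esym/eqP.
by apply/ffunP => -[].
Qed.

End MultiIndices.

(** * Orthogonality of the unfoldings, entry by entry *)

Section Unfoldings.
Variables (K : rcfType).

Lemma big_mxvec_index p q (F : 'I_(p * q) -> K) :
  \sum_k F k = \sum_i \sum_j F (mxvec_index i j).
Proof.
rewrite pair_bigA /= (reindex _ (curry_mxvec_bij p q)) /=.
by apply: eq_bigr => -[].
Qed.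

Lemma lunfoldE p n q (C : core K p n q) i a b :
  lunfold C (mxvec_index i a) b = C (a, i, b).
Proof. by rewrite mxE mxvecE mxE. Qed.

Lemma runfoldE p n q (C : core K p n q) a b i :
  runfold C a (mxvec_index b i) = C (a, i, b).
Proof. by rewrite mxE mxvecE mxE. Qed.

Lemma munfoldE p n q (C : core K p n q) i b a :
  munfold C i (mxvec_index b a) = C (a, i, b).
Proof. by rewrite mxE mxvecE mxE. Qed.

Lemma right_orthogonalE p n q (C : core K p n q) a a' :
  right_orthogonal C ->
  \sum_i \sum_b C (a, i, b) * C (a', i, b) = (a == a')%:R.
Proof.
move=> /matrixP/(_ a a'); rewrite mxE [1%:M _ _]mxE => <-.
rewrite big_mxvec_index exchange_big /=; apply: eq_bigr => b _.
by apply: eq_bigr => i _; rewrite [X in _ = _ * X]mxE !runfoldE.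
Qed.

Lemma left_orthogonalE p n q (C : core K p n q) b b' :
  left_orthogonal C ->
  \sum_a \sum_i C (a, i, b) * C (a, i, b') = (b == b')%:R.
Proof.
move=> /matrixP/(_ b b'); rewrite mxE [1%:M _ _]mxE => <-.
rewrite big_mxvec_index exchange_big /=; apply: eq_bigr => i _.
by apply: eq_bigr => a _; rewrite [X in _ = X * _]mxE !lunfoldE.
Qed.

Lemma orthonormal_colsE m n (U : 'M[K]_(m, n)) s s' :
  orthonormal_cols U -> \sum_x U x s * U x s' = (s == s')%:R.
Proof.
move=> /matrixP/(_ s s'); rewrite mxE [1%:M _ _]mxE => <-.
by apply: eq_bigr => x _; rewrite mxE.
Qed.

End Unfoldings.

(** * Tensor trains with an open left boundary index *)

Section TensorTrains.
Variable K : rcfType.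

(* The TT with its left boundary index a left open; the right boundary index
   is summed over, as in tt_tensor. *)
Fixpoint tt_open (D : nat) : forall (n r : nat -> nat)
    (C : forall d, core K (r d) (n d) (r d.+1)), 'I_(r 0%N) -> midx D n -> K :=
  match D with
  | 0 => fun n r C a i => 1
  | D'.+1 => fun n r C a i =>
      \sum_(b < r 1%N) C 0%N (a, i ord0, b) *
        @tt_open D' (fun d => n d.+1) (fun d => r d.+1) (fun d => C d.+1) b
          (midx_tail i)
  end.

Lemma tt_openS D (n r : nat -> nat) (C : forall d, core K (r d) (n d) (r d.+1))
    a x j :
  tt_open C a (midx_cons x j) =
  \sum_b C 0%N (a, x, b) *
    @tt_open D (fun d => n d.+1) (fun d => r d.+1) (fun d => C d.+1) b j.
Proof. by rewrite /= midx_cons0 midx_consK. Qed.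

Lemma tt_openE D (n r : nat -> nat) (C : forall d, core K (r d) (n d) (r d.+1))
    a i :
  tt_open C a i =
  \sum_(b : midx D (fun d => r d.+1)) \prod_(d < D)
    C d (midx_cons a b (widen_ord (leqnSn D) d), i d,
         midx_cons a b (lift ord0 d)).
Proof.
elim: D n r C a i => [|D IH] n r C a i.
  by under eq_bigr => b _ do rewrite big_ord0; rewrite big_midx0.
rewrite /= big_midxS; apply: eq_bigr => b _.
rewrite IH big_distrr /=; apply: eq_bigr => c _.
rewrite big_ord_recl.
rewrite midx_cons_widen0 midx_consS midx_cons0; congr (_ * _).
apply: eq_bigr => d _.
by rewrite midx_cons_widenS !midx_consS [midx_tail i d]ffunE.
Qed.

Lemma tt_tensorE D (n r : nat -> nat) (C : forall d, core K (r d) (n d) (r d.+1))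
    i :
  tt_tensor D C i = \sum_a tt_open C a i.
Proof.
rewrite ffunE (big_midxS (n := r)); apply: eq_bigr => a _.
by rewrite tt_openE.
Qed.

(** By induction, summing over the tail identifies the two bond indices, and what remains is the
    right-orthogonality relation of the first core. The induction starts from the right boundary
    rank 1. *)
Lemma tt_open_orthonormal D (n r : nat -> nat)
    (C : forall d, core K (r d) (n d) (r d.+1)) a a' :
  r D = 1%N -> (forall d, (d < D)%N -> right_orthogonal (C d)) ->
  \sum_(i : midx D n) tt_open C a i * tt_open C a' i = (a == a')%:R.
Proof.
elim: D n r C a a' => [|D IH] n r C a a' rD orthC.
  by rewrite /= big_midx0 mulr1 (ord_eq1 a a' rD) eqxx.
rewrite big_midxS -(right_orthogonalE a a' (orthC 0%N isT)).
apply: eq_bigr => x _.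
under eq_bigr => j _ do rewrite !tt_openS big_distrlr /=.
rewrite exchange_big /=; apply: eq_bigr => b _.
rewrite exchange_big /= (bigD1 b) //= [X in _ + X]big1 => [|b' ne];
  (under eq_bigr => j _ do rewrite mulrACA); rewrite -big_distrr /=;
  rewrite (IH (fun d => n d.+1) (fun d => r d.+1) (fun d => C d.+1)) //;
  try by move=> d; exact: (orthC d.+1).
- by rewrite eqxx mulr1 addr0.
- by rewrite eq_sym (negbTE ne) mulr0.
Qed.

Definition core_modeprod2 p s n q (S : core K p s q) (U : 'M[K]_(n, s)) :
    core K p n q :=
  [ffun y => \sum_t S (y.1.1, t, y.2) * U y.1.2 t].

(** Each factor matrix acts on the index of a single core, so the Tucker product can be absorbed
    into the train site by site without touching the ranks. *)
Lemma tt_open_tucker D (n s r : nat -> nat)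
    (S : forall d, core K (r d) (s d) (r d.+1))
    (U : forall d, 'M[K]_(n d, s d)) a (i : midx D n) :
  \sum_(t : midx D s) tt_open S a t * \prod_(d < D) U d (i d) (t d)
  = tt_open (fun d => core_modeprod2 (S d) (U d)) a i.
Proof.
elim: D n s r S U a i => [|D IH] n s r S U a i.
  by under eq_bigr => t _ do rewrite big_ord0 mulr1; rewrite big_midx0.
rewrite big_midxS /=.
under [RHS]eq_bigr => b _ do rewrite ffunE /= -IH big_distrl /=.
rewrite [RHS]exchange_big /=; apply: eq_bigr => x _.
under eq_bigr => t _ do rewrite big_distrl /=.
rewrite exchange_big /=; apply: eq_bigr => b _.
rewrite big_distrr /=; apply: eq_bigr => t _.
rewrite midx_consK big_ord_recl !midx_cons0 mulrACA; congr (_ * (_ * _)).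
by apply: eq_bigr => d _; rewrite midx_consS [midx_tail i d]ffunE.
Qed.

Lemma tucker_tt_tensorE D (n s r : nat -> nat)
    (S : forall d, core K (r d) (s d) (r d.+1))
    (U : forall d, 'M[K]_(n d, s d)) (i : midx D n) :
  tucker (tt_tensor D S) U i
  = \sum_a tt_open (fun d => core_modeprod2 (S d) (U d)) a i.
Proof.
rewrite tuckerE; under eq_bigr => t _ do rewrite tt_tensorE big_distrl /=.
by rewrite exchange_big /=; apply: eq_bigr => a _; rewrite tt_open_tucker.
Qed.

End TensorTrains.

(** * The residual of a truncated SVD *)

Section TruncatedSVD.
Variable K : rcfType.

Lemma sum_sqr_mxtrace m n (M : 'M[K]_(m, n)) :
  \sum_i \sum_j M i j ^+ 2 = \tr (M *m M^T).
Proof.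
apply: eq_bigr => i _; rewrite mxE; apply: eq_bigr => j _.
by rewrite mxE expr2.
Qed.

(** In the full singular bases the residual is the diagonal matrix of the discarded singular values,
    from which all three facts can be read off. *)
Lemma truncated_svdP m n k (M : 'M[K]_(m, n)) (U : 'M[K]_(m, k)) s
    (V : 'M[K]_(n, k)) (E := M - U *m svt s V) :
  is_truncated_svd M U s V ->
  [/\ orthonormal_cols U, U^T *m E = 0
    & \sum_i \sum_j E i j ^+ 2 = \sum_(k <= i < m) s i ^+ 2].
Proof.
case=> km [kn] [U' [V' [[orthU orthV [_ _ s0] defM] defU defV]]].
pose Z : 'M[K]_(m, n) :=
  \matrix_(i, j) if (i == j :> nat) && (k <= i)%N then s i else 0.
have defE : E = U' *m Z *m V'^T.
  rewrite /E defM (_ : \matrix_(i, j) _ = Z + (\matrix_(i, j)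
      if (i == j :> nat) && (i < k)%N then s i else 0)); last first.
    apply/matrixP => i j; rewrite !mxE leqNgt.
    by case: (_ == _); case: (_ < _)%N => /=; rewrite ?addr0 ?add0r.
  rewrite mulmxDr mulmxDl; apply/eqP; rewrite subr_eq addrC eq_sym; apply/eqP.
  rewrite addrC; congr (_ + _).
  (* Column selection as a product with a truncated identity: [U'] and [V'^T] then cancel on both
     sides and only diagonal matrices are compared. *)
  have colsubE (p q : nat) (kp : (k <= p)%N) (N : 'M[K]_(q, p)) :
      colsub (widen_ord kp) N = N *m colsub (widen_ord kp) 1%:M.
    apply/matrixP => i j; rewrite !mxE (bigD1 (widen_ord kp j)) //= big1 => [|l ne].
      by rewrite !mxE eqxx mulr1 addr0.
    by rewrite !mxE (negbTE ne) mulr0.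
  rewrite /svt defU defV (colsubE _ _ km) (colsubE _ _ kn) trmx_mul !mulmxA.
  congr (_ *m _); rewrite -!mulmxA; congr (_ *m _).
  rewrite mulmxA mul_mx_diag; apply/matrixP => i j; rewrite !mxE.
  have [lt_ik|le_ki] := ltnP i k; last first.
    rewrite andbF big1 // => l _; rewrite !mxE -val_eqE /= gtn_eqF ?mul0r //.
    exact: leq_trans le_ki.
  rewrite (bigD1 (Ordinal lt_ik)) //= big1 => [|l].
    rewrite !mxE -!val_eqE /= eqxx mul1r addr0 andbT eq_sym.
    by case: eqP; rewrite ?mulr1 ?mulr0.
  by rewrite !mxE -!val_eqE /= eq_sym => /negbTE->; rewrite !mul0r.
have UU : U^T *m U' = \matrix_(i < k, j < m) (i == j :> nat)%:R.
  apply/matrixP => i j; rewrite !mxE.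
  rewrite -(orthonormal_colsE (widen_ord km i) j orthU).
  by apply: eq_bigr => x _; rewrite defU !mxE.
split.
- apply/matrixP => i j; rewrite !mxE.
  have := orthonormal_colsE (widen_ord km i) (widen_ord km j) orthU.
  rewrite -val_eqE /= => <-; apply: eq_bigr => x _.
  by rewrite defU !mxE.
(* [U^T *m U'] selects the first [k] rows, where [Z] vanishes. *)
- rewrite defE !mulmxA UU (_ : _ *m Z = 0) ?mul0mx //.
  apply/matrixP => i j; rewrite !mxE big1 // => x _; rewrite !mxE.
  have [<-|_] := eqVneq (i : nat) (x : nat); last by rewrite mul0r.
  by rewrite leqNgt ltn_ord andbF mulr0.
(* Unitary invariance of the Frobenius norm, through cyclicity of the trace, reduces the claim to
   [Z]. *)
- rewrite sum_sqr_mxtrace defE !trmx_mul trmxK !mulmxA -(mulmxA _ V'^T) orthV.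
  rewrite mulmx1 mxtrace_mulC !mulmxA orthU mul1mx -sum_sqr_mxtrace.
  rewrite big_geq_mkord [RHS]big_mkcond; apply: eq_bigr => i _ /=.
  (* A row with [n <= i] has no diagonal entry; it matches the sum because [s i] is a padding zero
     there. *)
  have [lt_in|le_ni] := ltnP i n; last first.
    by rewrite s0 ?geq_min ?le_ni ?orbT // expr0n if_same big1 // => j _;
      rewrite mxE s0 ?geq_min ?le_ni ?orbT // if_same expr0n.
  rewrite (bigD1 (Ordinal lt_in)) //= big1 => [|j].
    by rewrite mxE eqxx addr0 /=; case: ifP => //; rewrite expr0n.
  by rewrite mxE -val_eqE /= eq_sym => /negbTE->; rewrite expr0n.
Qed.

End TruncatedSVD.

(** * One truncation step, and the accumulation of errors along the train *)

Section ErrorFormula.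
Variable K : rcfType.

(** [G] stands for the original tail, [X] for the exact tail after the QR update and [Y] for the
    computed one. Keeping them abstract covers both an inner site and the last site, where all three
    are constantly 1. *)
Lemma truncation_step p n s q q' (J : finType) (B : core K p n q)
    (T : core K p s q) (S : core K p s q') (U : 'M[K]_(n, s))
    (E := munfold B - U *m munfold T)
    (G : 'I_q -> J -> K) (X Y : 'I_q' -> J -> K) :
  orthonormal_cols U -> U^T *m E = 0 ->
  (forall b b', \sum_j G b j * G b' j = (b == b')%:R) ->
  (forall a t j, \sum_b T (a, t, b) * G b j = \sum_c S (a, t, c) * X c j) ->
  \sum_a \sum_x \sum_j (\sum_b B (a, x, b) * G b j
     - \sum_c core_modeprod2 S U (a, x, c) * Y c j) ^+ 2
  = \sum_x \sum_k E x k ^+ 2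
    + \sum_a \sum_t \sum_j (\sum_c S (a, t, c) * (X c j - Y c j)) ^+ 2.
Proof.
move=> orthU UE0 orthG TGE.
have EE x b a : E x (mxvec_index b a)
    = B (a, x, b) - \sum_t U x t * T (a, t, b).
  rewrite !mxE mxvecE mxE; congr (_ - _); apply: eq_bigr => t _.
  by rewrite munfoldE.
(* Contracting the residual with the orthonormal family [G] keeps its norm and puts it over the same
   indices as the left-hand side. *)
have -> : \sum_x \sum_k E x k ^+ 2
    = \sum_a \sum_j \sum_x (\sum_b G b j * E x (mxvec_index b a)) ^+ 2.
  under [RHS]eq_bigr => a _ do rewrite exchange_big /=.
  rewrite [RHS]exchange_big /=; apply: eq_bigr => x _.
  rewrite big_mxvec_index exchange_big /=; apply: eq_bigr => a _.
  by rewrite (sum_sqr_isometry (U := fun j b => G b j)).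
rewrite -big_split; apply: eq_bigr => a _ /=.
rewrite exchange_big [X in _ = _ + X]exchange_big -big_split.
apply: eq_bigr => j _ /=.
rewrite -(sum_sqr_pythagoras (U := fun x t => U x t)) => [|t t'|t].
- apply: eq_bigr => x _; congr (_ ^+ 2).
  (* Split [B] into its residual and the retained part [U] times [T], then exchange [T] with [G] for
     [S] with [X]. *)
  have -> : \sum_b B (a, x, b) * G b j
      = \sum_b G b j * E x (mxvec_index b a)
        + \sum_t U x t * \sum_c S (a, t, c) * X c j.
    under [X in _ = _ + X]eq_bigr => t _ do rewrite -TGE mulr_sumr.
    rewrite exchange_big -big_split; apply: eq_bigr => b _ /=.
    rewrite EE mulrBr mulrC -[LHS](subrK (G b j * \sum_t U x t * T (a, t, b))).
    congr (_ + _); rewrite mulr_sumr; apply: eq_bigr => t _.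
    by rewrite mulrCA [G b j * _]mulrC.
  have -> : \sum_c core_modeprod2 S U (a, x, c) * Y c j
      = \sum_t U x t * \sum_c S (a, t, c) * Y c j.
    under [RHS]eq_bigr => t _ do rewrite mulr_sumr.
    rewrite exchange_big; apply: eq_bigr => c _ /=.
    rewrite ffunE mulr_suml; apply: eq_bigr => t _ /=.
    by rewrite mulrA [U x t * _]mulrC.
  rewrite -addrA -sumrB; congr (_ + _); apply: eq_bigr => t _.
  rewrite -mulrBr -sumrB; congr (_ * _); apply: eq_bigr => c _.
  by rewrite mulrBr.
- exact: orthonormal_colsE.
- under eq_bigr => x _ do rewrite mulr_sumr.
  rewrite exchange_big /= big1 // => b _.
  under eq_bigr => x _ do rewrite mulrCA.
  rewrite -mulr_sumr; have /matrixP/(_ t (mxvec_index b a)) := UE0.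
  rewrite mxE [RHS]mxE; under eq_bigr => x _ do rewrite [U^T _ _]mxE.
  by move=> ->; rewrite mulr0.
Qed.

(** Induction on the number of sites, shifting every family by one. The left rank [p 0] stays
    arbitrary and its index is summed over, since the remaining train starts at an inner bond. *)
Lemma hosvd_error D (n r p s : nat -> nat)
    (C : forall d, core K (r d) (n d) (r d.+1))
    (B : forall d, core K (p d) (n d) (r d.+1))
    (T : forall d, core K (p d) (s d) (r d.+1))
    (S : forall d, core K (p d) (s d) (p d.+1))
    (R : forall d, 'M[K]_(p d.+1, r d.+1)) (U : forall d, 'M[K]_(n d, s d))
    (E := fun d => munfold (B d) - U d *m munfold (T d)) :
  r D.+1 = 1%N ->
  (forall d, (0 < d <= D)%N -> right_orthogonal (C d)) ->
  (forall d, (d <= D)%N -> orthonormal_cols (U d) /\ (U d)^T *m E d = 0) ->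
  (forall d, (d < D)%N ->
    [/\ lunfold (T d) = lunfold (S d) *m R d, left_orthogonal (S d)
      & B d.+1 = core_modeprod1 (C d.+1) (R d)]) ->
  core_eq (S D) (T D) ->
  \sum_a \sum_(i : midx D.+1 n)
    (\sum_b B 0%N (a, i ord0, b) *
       tt_open (fun d => C d.+1) b (midx_tail i)
     - tt_open (fun d => core_modeprod2 (S d) (U d)) a i) ^+ 2
  = \sum_(d < D.+1) \sum_x \sum_k E d x k ^+ 2.
Proof.
elim: D n r p s C B T S R U @E => [|D IH] n r p s C B T S R U E r1 orthC svdU qr ST.
  have [orthU0 UE0] := svdU 0%N isT.
  rewrite big_ord1.
  (* Beyond the last site both tails are the empty product 1, so the second summand of
     [truncation_step] is inserted as a zero term. *)
  rewrite -[RHS]addr0 -[X in _ = _ + X](_ : \sum_a \sum_t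
    \sum_(j : midx 0 (fun d => n d.+1))
      (\sum_c S 0%N (a, t, c) * (1 - 1)) ^+ 2 = 0); last first.
    rewrite big1 // => a _; rewrite big1 // => t _; rewrite big1 // => j _.
    by rewrite subrr -mulr_suml mulr0 expr0n.
  rewrite -(truncation_step (B := B 0%N) (T := T 0%N) (S := S 0%N)
      (G := fun _ _ => 1) (X := fun _ _ => 1) (fun _ _ => 1)) //.
  - apply: eq_bigr => a _; rewrite big_midxS; apply: eq_bigr => x _.
    by apply: eq_bigr => j _; rewrite tt_openS midx_cons0.
  - by move=> b b'; rewrite big_midx0 mulr1 (ord_eq1 b b' r1) eqxx.
  move=> a t j; have [_ _ p1 STE] := ST.
  have b : 'I_(r 1%N) by rewrite r1; exact: ord0.
  rewrite (sum_ord_eq1 b) // (sum_ord_eq1 (cast_ord (esym p1) b)) ?p1 //.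
  by rewrite !mulr1; apply/esym/STE.
have [orthU0 UE0] := svdU 0%N isT.
have [TSR orthS BCR] := qr 0%N isT.
have orthG b b' : \sum_(j : midx D.+1 (fun d => n d.+1))
    tt_open (fun d => C d.+1) b j * tt_open (fun d => C d.+1) b' j
    = (b == b')%:R.
  by apply: tt_open_orthonormal => // d dD; exact: orthC.
rewrite big_ord_recl -(IH (fun d => n d.+1) (fun d => r d.+1) (fun d => p d.+1)
  (fun d => s d.+1) (fun d => C d.+1) (fun d => B d.+1) (fun d => T d.+1)
  (fun d => S d.+1) (fun d => R d.+1) (fun d => U d.+1)) //; last first.
- by move=> d; exact: qr d.+1.
- by move=> d; exact: svdU d.+1.
- by move=> d /andP[_ dD]; apply: orthC.
(* The exact tail from the next site on, starting with the updated core; [Y] is its computed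
   counterpart. *)
pose X c (j : midx D.+1 (fun d => n d.+1)) :=
  \sum_b B 1%N (c, j ord0, b) * tt_open (fun d => C d.+2) b (midx_tail j).
pose Y := @tt_open K D.+1 _ _ (fun d => core_modeprod2 (S d.+1) (U d.+1)).
have TGE a t j :
    \sum_b T 0%N (a, t, b) * tt_open (fun d => C d.+1) b j
    = \sum_c S 0%N (a, t, c) * X c j.
  have TE b : T 0%N (a, t, b) = \sum_c S 0%N (a, t, c) * R 0%N c b.
    rewrite -lunfoldE TSR mxE; apply: eq_bigr => c _.
    by rewrite lunfoldE.
  (* Updating the next core by [R] amounts to multiplying the whole original tail by [R]. *)
  have XE c : X c j = \sum_b R 0%N c b * tt_open (fun d => C d.+1) b j.
    rewrite /X BCR /=.
    under eq_bigr => b _ do rewrite ffunE mulr_suml /=.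
    rewrite exchange_big /=; apply: eq_bigr => b' _.
    rewrite mulr_sumr; apply: eq_bigr => b _.
    by rewrite mulrAC mulrC.
  under eq_bigr => b _ do rewrite TE mulr_suml.
  rewrite exchange_big /=; apply: eq_bigr => c _.
  by rewrite XE mulr_sumr; apply: eq_bigr => b _; rewrite mulrA.
transitivity (\sum_x \sum_k E 0%N x k ^+ 2 + \sum_a \sum_t \sum_j
    (\sum_c S 0%N (a, t, c) * (X c j - Y c j)) ^+ 2).
  rewrite -(truncation_step _ orthU0 UE0 orthG TGE).
  apply: eq_bigr => a _; rewrite big_midxS; apply: eq_bigr => x _.
  by apply: eq_bigr => j _; rewrite tt_openS midx_cons0 midx_consK.
congr (_ + _); rewrite pair_bigA exchange_big [RHS]exchange_big /=.
apply: eq_bigr => j _.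
(* With its first two indices paired, the left-orthogonal core [S 0] has orthonormal columns and
   drops out of the norm. *)
rewrite (sum_sqr_isometry (U := fun y c => S 0%N (y.1, y.2, c))) //.
by move=> c c'; rewrite -(left_orthogonalE c c' orthS) pair_bigA.
Qed.

End ErrorFormula.

Theorem theorem3p5 (K : rcfType) (D : nat) (I r : nat -> nat)
    (A : tensor K D I) (C : forall d : nat, core K (r d) (I d) (r d.+1))
    (eps : K) (x : hosvd_run D C (eps * fnorm A / Num.sqrt D%:R)) :
  (0 < D)%N -> is_tt A C -> mixed_canonical D C 0 ->
  frob2 (A - run_output x)
  = \sum_(d < D) \sum_(run_size x d <= i < I d) run_sigma x d i ^+ 2.
Proof.
case: D A x => // D A x _ [r0 r1 AE] [_ orthC].
have [p0 _ _ BC] := run_init x.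
have svdU d (dD : (d < D.+1)%N) :
    let E := munfold (run_cur x d) - run_U x d *m munfold (run_T x d) in
    [/\ orthonormal_cols (run_U x d), (run_U x d)^T *m E = 0
      & \sum_i \sum_j E i j ^+ 2
        = \sum_(run_size x d <= i < I d) run_sigma x d i ^+ 2].
  by have [_ /truncated_svdP svdU _ ->] := run_svd x dD.
under [RHS]eq_bigr => d _ do have [_ _ <-] := svdU d (ltn_ord d).
rewrite -(hosvd_error (C := C) (R := run_R x) (S := run_S x)) //.
(* Left rank 1 collapses the open boundary sums to single terms; the initial core is matched with
   [C 0] through [core_eq], as the ranks agree only propositionally. *)
- have a : 'I_(run_rank x 0) by rewrite p0 r0; exact: ord0.
  rewrite (sum_ord_eq1 a) ?p0 //; apply: eq_bigr => i _.
  rewrite ffunE [X in _ + X]ffunE tucker_tt_tensorE (sum_ord_eq1 a) ?p0 //.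
  congr ((_ - _) ^+ 2); rewrite [in LHS]AE tt_tensorE.
  rewrite (sum_ord_eq1 (cast_ord p0 a)) //.
  by apply: eq_bigr => b _; congr (_ * _); apply/esym/BC.
- by move=> d dD; have [] := svdU d dD.
- move=> d dD; have [[_ ? _ ?] ?] := run_qr x (dD : (d.+1 < D.+1)%N).
  by split.
- exact: run_last.
Qed.
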